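(* Let $b:\mathbb{R}^d\times\mathcal{P}(\mathbb{R}^d)\to\mathbb{R}^d$, $\sigma:\mathbb{R}^d\times\mathcal{P}(\mathbb{R}^d)\to\mathbb{R}^{d\times m_1}$, $\overline\sigma:\mathbb{R}^d\times\mathcal{P}(\mathbb{R}^d)\to\mathbb{R}^{d\times m_2}$ and $\sigma_0,\sigma_1\in\mathbb{R}$. Suppose: (i) $b(\cdot,\delta_0)$ is locally Lipschitz continuous and there are constants $\lambda_1>0$, $l_0\ge 1$ and an increasing continuous function $\phi:[0,\infty)\to[0,\infty)$ with $\phi(0)=0$ such that for all $x,y\in\mathbb{R}^d$, $\mu\in\mathcal{P}_1(\mathbb{R}^d)$, $$\langle x-y,b(x,\mu)-b(y,\mu)\rangle\le |x-y|\phi(|x-y|)\mathbf{1}_{\{|x-y|\le l_0\}}-\lambda_1|x-y|^2\mathbf{1}_{\{|x-y|>l_0\}};$$ moreover there is $\lambda_2>0$ such that $|b(x,\mu)-b(x,\nu)|\le\lambda_2\mathbb{W}_1(\mu,\nu)$ for all $x\in\mathbb{R}^d$, $\mu,\nu\in\mathcal{P}_1(\mathbb{R}^d)$; (ii) there is $\hat L>0$ such that $|\sigma(x,\mu)|\vee|\overline\sigma(x,\mu)|\le\hat L$ for all $x\in\mathbb{R}^d$, $\mu\in\mathcal{P}_1(\mathbb{R}^d)$; (iii) $\lambda_1>2\lambda_2$. Let $(X_{nh}^{i,N,h})_{n\ge0,\,i\in\mathbb{S}_N}$ be the backward Euler–Maruyama scheme defined in the context. Then for any $p\ge1$ and $h\in(0,h_p]$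 with $$h_p=1\wedge\frac{\lambda_1-2\lambda_2}{2p(1+\lambda_2)^p},$$ there exists a constant $C>0$ such that for all $n\ge0$ and $i\in\mathbb{S}_N$, $$\mathbb{E}|X_{nh}^{i,N,h}|^p\le\mathrm{e}^{-\gamma^*nh}\,\mathbb{E}|X_0^{i,N,h}|^p+C$$ in case $\mathbb{E}|X_0^{i,N,h}|^p<\infty$, where $\gamma^*=\frac{\lambda_1-2\lambda_2}{2+3(2\lambda_1-3\lambda_2)}$.
   Context: Notation. $|\cdot|$ is the Euclidean norm of vectors and the Hilbert–Schmidt norm of matrices; $a\vee b=\max\{a,b\}$, $a\wedge b=\min\{a,b\}$; $\delta_x$ is the Dirac mass at $x$; $\mathbb{S}_N=\{1,\dots,N\}$. $\mathcal{P}(\mathbb{R}^d)$ is the set of Borel probability measures on $\mathbb{R}^d$, $\mathcal{P}_1(\mathbb{R}^d)$ those with finite first moment, and $\mathbb{W}_1(\mu,\nu)=\inf_{\pi}\int|x-y|\,\pi(\mathrm{d}x,\mathrm{d}y)$, the infimum over couplings $\pi$ of $\mu$ and $\nu$. Probability spaces. $(\Omega^B,\mathcal{F}^B,(\mathcal{F}^B_t)_{t\ge0},\mathbb{P}^B)$ and $(\Omega^W,\mathcal{F}^W,(\mathcal{F}^W_t)_{t\ge0},\mathbb{P}^W)$ are complete filtered probability spaces satisfying the usual conditions; $\Omega=\Omega^B\times\Omega^W$, $\mathbb{P}=\mathbb{P}^B\times\mathbb{P}^W$, with expectation $\mathbb{E}$. On $\Omega^B$ there are Brownian motions $B^i$ (dimension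 $d$) and $\overline B^i$ (dimension $m_1$), $i\in\mathbb{S}_N$; on $\Omega^W$ there are Brownian motions $W$ (dimension $d$) and $\overline W$ (dimension $m_2$); all are mutually independent. Backward Euler–Maruyama scheme with step size $h>0$: for $n\ge0$, $i\in\mathbb{S}_N$, $$X_{(n+1)h}^{i,N,h}=X_{nh}^{i,N,h}+b(X_{(n+1)h}^{i,N,h},\widetilde\mu_{nh}^{N,h})h+\sigma_0\Delta B_n^i+\sigma(X_{nh}^{i,N,h},\widetilde\mu_{nh}^{N,h})\Delta\overline B_n^i+\sigma_1\Delta W_n+\overline\sigma(X_{nh}^{i,N,h},\widetilde\mu_{nh}^{N,h})\Delta\overline W_n,$$ where $\Delta B_n^i=B^i_{(n+1)h}-B^i_{nh}$ and similarly for $\Delta\overline B_n^i,\Delta W_n,\Delta\overline W_n$, and $\widetilde\mu_{nh}^{N,h}=\frac1N\sum_{j=1}^N\delta_{X_{nh}^{j,N,h}}$. The scheme is understood to be well defined (the implicit equation uniquely solvable at each step). The initial data $(X_0^{i,N,h})_{i\in\mathbb{S}_N}$ are i.i.d. and $\mathcal{F}_0^B$-measurable. *)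

(* Defs.v *)
From HB Require Import structures.
From mathcomp Require Import all_boot all_order all_algebra.
From mathcomp Require Import all_classical all_reals all_analysis.

Set Implicit Arguments.
Unset Strict Implicit.
Unset Printing Implicit Defensive.

Import Order.TTheory GRing.Theory Num.Theory.
Import numFieldNormedType.Exports.

Local Open Scope classical_set_scope.
Local Open Scope ring_scope.

(* Matrices carry the Borel sigma-algebra of their (finite-dimensional)
   topology; R^d is 'cV[R]_d. *)
HB.instance Definition _ (R : realType) (m n : nat) :=
  @isMeasurable.Build (sigma_display (@open 'M[R]_(m, n))) 'M[R]_(m, n)
    <<s @open 'M[R]_(m, n) >>
    (@sigma_algebra0 _ setT (@open 'M[R]_(m, n)))
    (@sigma_algebraC _ (@open 'M[R]_(m, n)))
    (@sigma_algebra_bigcup _ setT (@open 'M[R]_(m, n))).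

(* Hilbert-Schmidt norm; on 'cV[R]_d this is the Euclidean norm.  The library
   norm `|A| on matrices is the sup norm. *)
Definition hsnorm (R : realType) (m n : nat) (A : 'M[R]_(m, n)) : R :=
  Num.sqrt (\sum_(i < m) \sum_(j < n) A i j ^+ 2).

Definition inner (R : realType) (d : nat) (x y : 'cV[R]_d) : R :=
  \sum_(i < d) x i 0 * y i 0.

Definition locally_lipschitz (R : realType) (d : nat)
    (f : 'cV[R]_d -> 'cV[R]_d) : Prop :=
  forall x, exists r L : R, 0 < r /\
    forall y z, hsnorm (y - x) < r -> hsnorm (z - x) < r ->
      hsnorm (f y - f z) <= L * hsnorm (y - z).

Section wasserstein.
Local Open Scope ereal_scope.
Context (R : realType) (d : nat).
Implicit Types mu nu : probability 'cV[R]_d R.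

Definition finite_first_moment mu : Prop :=
  \int[mu]_x (hsnorm x)%:E < +oo.

Definition coupling mu nu
    (pi : probability ('cV[R]_d * 'cV[R]_d)%type R) : Prop :=
  forall A, measurable A ->
    pi (A `*` [set: 'cV[R]_d]) = mu A /\ pi ([set: 'cV[R]_d] `*` A) = nu A.

Definition wasserstein1 mu nu : \bar R :=
  ereal_inf [set \int[pi]_z (hsnorm (z.1 - z.2)%R)%:E | pi in coupling mu nu].

End wasserstein.

Section empirical.
Local Open Scope ereal_scope.
Context (R : realType) (d N : nat) (x : 'I_N.+1 -> 'cV[R]_d).

(* N.+1 particles: the empirical measure of an empty family is not a
   probability. *)
Definition empirical (A : set 'cV[R]_d) : \bar R :=
  (N.+1%:R^-1)%R%:E * \sum_(j < N.+1) \d_(x j) A.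

Let empiricalE : empirical =
  mscale ((N.+1%:R^-1)%:nng)%R (msum (fun k => \d_(x (inord k))) N.+1).
Proof.
apply/funext => A; rewrite /empirical /mscale /msum /=; congr (_ * _).
by apply: eq_bigr => j _; rewrite inord_val.
Qed.

Let empirical0 : empirical set0 = 0.
Proof. by rewrite empiricalE measure0. Qed.

Let empirical_ge0 A : 0 <= empirical A.
Proof. by rewrite empiricalE measure_ge0. Qed.

Let empirical_sigma_additive : semi_sigma_additive empirical.
Proof. rewrite empiricalE; exact: measure_semi_sigma_additive. Qed.

HB.instance Definition _ := isMeasure.Build _ _ _ empirical
  empirical0 empirical_ge0 empirical_sigma_additive.

Let empirical_setT : empirical setT = 1.
Proof.
rewrite /empirical; under eq_bigr do rewrite diracT.
rewrite sumEFin sumr_const card_ord -EFinM mulVf ?pnatr_eq0//.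
Qed.

HB.instance Definition _ := Measure_isProbability.Build _ _ _ empirical
  empirical_setT.

End empirical.

Section stochastic_basis.
Local Open Scope ereal_scope.
Context (R : realType) (disp : measure_display) (O : measurableType disp)
  (P : probability O R).

(* Families of sets are indexed by all of R but only the times t >= 0 matter. *)
Record usual_conditions (F : R -> set_system O) : Prop := {
  usual_complete : measure_is_complete P ;
  usual_sigma_algebra : forall t, (0 <= t)%R -> sigma_algebra [set: O] (F t) ;
  usual_measurable : forall t, (0 <= t)%R -> F t `<=` measurable ;
  usual_monotone : forall s t, (0 <= s)%R -> (s <= t)%R -> F s `<=` F t ;
  usual_right_continuous : forall t, (0 <= t)%R ->
    F t = \bigcap_(s in [set s | (t < s)%R]) F s ;
  usual_null_sets : P.-negligible `<=` F 0%R }.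

Definition mutually_independent (I : finType) (G : I -> set_system O) : Prop :=
  forall (J : {set I}) (A : I -> set O), (forall i, i \in J -> G i (A i)) ->
    P (\bigcap_(i in [set` J]) A i) = \prod_(i in J) P (A i).

(* Standard k-dimensional Brownian motion relative to the filtration F.  The
   second argument of normal_prob is the standard deviation. *)
Record brownian_motion (k : nat) (F : R -> set_system O)
    (B : R -> O -> 'cV[R]_k) : Prop := {
  brownian_adapted : forall t A, (0 <= t)%R -> measurable A ->
    F t (B t @^-1` A) ;
  brownian_start : {ae P, forall w, B 0%R w = 0%R} ;
  brownian_continuous : {ae P, forall w,
    {within [set t : R | (0 <= t)%R], continuous (fun t => B t w)}} ;
  brownian_independent : forall s t G A, (0 <= s < t)%R ->
    F s G -> measurable A ->
    P (G `&` [set w | A (B t w - B s w)%R]) =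
    P G * P [set w | A (B t w - B s w)%R] ;
  brownian_gaussian : forall s t (A : 'I_k -> set R), (0 <= s < t)%R ->
    (forall j, measurable (A j)) ->
    P [set w | forall j, A j ((B t w - B s w)%R j 0%R)] =
    \prod_(j < k) normal_prob 0%R (Num.sqrt (t - s)) (A j) }.

Definition process_sigma (k : nat) (B : R -> O -> 'cV[R]_k) : set_system O :=
  <<s \bigcup_(t in [set t : R | (0 <= t)%R])
        preimage_set_system [set: O] (B t) measurable >>.

Definition iid (I : finType) (k : nat) (xi : I -> O -> 'cV[R]_k) : Prop :=
  mutually_independent
    (fun i => preimage_set_system [set: O] (xi i) measurable) /\
  forall i j A, measurable A -> P (xi i @^-1` A) = P (xi j @^-1` A).

End stochastic_basis.

Section backward_euler_maruyama.
Context (R : realType) (d m1 m2 N : nat).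
Variables (b : 'cV[R]_d -> probability 'cV[R]_d R -> 'cV[R]_d)
  (sigma : 'cV[R]_d -> probability 'cV[R]_d R -> 'M[R]_(d, m1))
  (sigmab : 'cV[R]_d -> probability 'cV[R]_d R -> 'M[R]_(d, m2))
  (sigma0 sigma1 : R).
Context (dB dW : measure_display) (OB : measurableType dB)
  (OW : measurableType dW) (PB : probability OB R) (PW : probability OW R).

(* All noises are lifted to the product space, so that mutual independence is
   one statement about the B^i, the bar B^i, W and bar W together. *)
Definition noise_sigma (B : 'I_N.+1 -> R -> OB -> 'cV[R]_d)
    (Bb : 'I_N.+1 -> R -> OB -> 'cV[R]_m1)
    (W : R -> OW -> 'cV[R]_d) (Wb : R -> OW -> 'cV[R]_m2)
    (k : ('I_N.+1 + 'I_N.+1) + bool) : set_system (OB * OW) :=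
  match k with
  | inl (inl i) => process_sigma (fun t (w : OB * OW) => B i t w.1)
  | inl (inr i) => process_sigma (fun t (w : OB * OW) => Bb i t w.1)
  | inr true => process_sigma (fun t (w : OB * OW) => W t w.2)
  | inr false => process_sigma (fun t (w : OB * OW) => Wb t w.2)
  end.

(* Almost surely, X n.+1 i is the one and only solution of the implicit
   equation of the step. *)
Definition bem_scheme (h : R)
    (B : 'I_N.+1 -> R -> OB -> 'cV[R]_d) (Bb : 'I_N.+1 -> R -> OB -> 'cV[R]_m1)
    (W : R -> OW -> 'cV[R]_d) (Wb : R -> OW -> 'cV[R]_m2)
    (X : nat -> 'I_N.+1 -> OB * OW -> 'cV[R]_d) : Prop :=
  forall n i, {ae (PB \x PW)%E, forall w,
    let mu := empirical (fun j => X n j w) in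
    let t := n%:R * h in
    let t' := n.+1%:R * h in
    unique (fun x : 'cV[R]_d =>
      x = X n i w + h *: b x mu
          + sigma0 *: (B i t' w.1 - B i t w.1)
          + sigma (X n i w) mu *m (Bb i t' w.1 - Bb i t w.1)
          + sigma1 *: (W t' w.2 - W t w.2)
          + sigmab (X n i w) mu *m (Wb t' w.2 - Wb t w.2))
      (X n.+1 i w)}.

End backward_euler_maruyama.

(* Main.v *)
Require Import Defs.
From HB Require Import structures.
From mathcomp Require Import all_boot all_order all_algebra.
From mathcomp Require Import all_classical all_reals all_analysis measurable_realfun.
From mathcomp Require Import ring lra.

Set Implicit Arguments.
Unset Strict Implicit.
Unset Printing Implicit Defensive.

Import Order.TTheory GRing.Theory Num.Theory.
Import numFieldNormedType.Exports.

Local Open Scope classical_set_scope.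
Local Open Scope ring_scope.

(** Dissipativity and the Lipschitz bound in the measure give
[<y, b(y, mu)> <= D - lambda1 |y|^2 + |y| (K + lambda2 m)], where [m] is the mean of
the [|X^j|] and bounds the distance [W_1(mu, delta_0)].  Pairing the implicit equation
with its solution [y] yields, pointwise, a bound
[|y| <= w1 |X^i| + w2 m + |z| + const] with [z] the noise of the step,
[w1 = 1 / (1 + lambda1 h)] and [w2 = lambda2 h / (1 + lambda1 h)].  Since
[rho = w1 + w2 < 1], Jensen's inequality with the weights [w1], [w2], [1 - rho] turns
this into [|y|^p <= w1 |X^i|^p + w2 mean_j |X^j|^p + Q (|z| + const)^p].  The noise
moments are Gaussian moments, so a common bound [a_n] on the [p]-th moments of all
particles obeys [a_(n+1) = rho a_n + const], and [rho <= 1 - gamma h <= exp(- gamma h)].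
Bounding the noise by the triangle inequality is affordable because [C] may
depend on [h]. *)

(** * Euclidean and Hilbert-Schmidt norms *)

(** Lagrange's identity: the double sum of the squares of a_i b_j - a_j b_i is twice the difference
    of the two sides. *)
Lemma sum_cauchy_schwarz (R : realType) (I : finType) (a b : I -> R) :
  (\sum_i a i * b i) ^+ 2 <= (\sum_i a i ^+ 2) * (\sum_i b i ^+ 2).
Proof.
have : 0 <= \sum_i \sum_j (a i * b j - a j * b i) ^+ 2.
  by apply: sumr_ge0 => i _; apply: sumr_ge0 => j _; exact: sqr_ge0.
have -> : \sum_i \sum_j (a i * b j - a j * b i) ^+ 2 =
    \sum_i \sum_j (a i ^+ 2 * b j ^+ 2)
    + \sum_i \sum_j (b i ^+ 2 * a j ^+ 2)
    - 2 * \sum_i \sum_j ((a i * b i) * (a j * b j)).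
  rewrite mulr_sumr -big_split -sumrB; apply: eq_bigr => i _ /=.
  rewrite mulr_sumr -big_split -sumrB; apply: eq_bigr => j _ /=.
  by ring.
rewrite -!big_distrlr/=; nra.
Qed.

Section hsnorm_theory.
Context (R : realType).

Lemma hsnorm_ge0 m n (A : 'M[R]_(m, n)) : 0 <= hsnorm A.
Proof. exact: sqrtr_ge0. Qed.

Lemma hsnormE d (x : 'cV[R]_d) : hsnorm x = Num.sqrt (\sum_i x i 0 ^+ 2).
Proof. by congr Num.sqrt; apply: eq_bigr => i _; rewrite big_ord1. Qed.

Lemma hsnorm_sqr d (x : 'cV[R]_d) : hsnorm x ^+ 2 = inner x x.
Proof.
by rewrite hsnormE sqr_sqrtr// sumr_ge0// => i _; exact: sqr_ge0.
Qed.

Lemma hsnorm0 d : hsnorm (0 : 'cV[R]_d) = 0.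
Proof. by rewrite hsnormE big1 ?sqrtr0// => i _; rewrite mxE expr0n. Qed.

Lemma innerDr d (x y z : 'cV[R]_d) : inner x (y + z) = inner x y + inner x z.
Proof.
by rewrite -big_split; apply: eq_bigr => i _; rewrite mxE mulrDr.
Qed.

Lemma innerZr d (a : R) (x y : 'cV[R]_d) : inner x (a *: y) = a * inner x y.
Proof.
by rewrite /inner mulr_sumr; apply: eq_bigr => i _; rewrite mxE mulrCA.
Qed.

Lemma inner_le_hsnorm d (x y : 'cV[R]_d) : inner x y <= hsnorm x * hsnorm y.
Proof.
apply: (le_trans (ler_norm _)); rewrite -ler_sqr ?nnegrE ?mulr_ge0 ?hsnorm_ge0//.
rewrite real_normK ?num_real// exprMn !hsnorm_sqr.
exact: sum_cauchy_schwarz.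
Qed.

Lemma hsnormD d (x y : 'cV[R]_d) : hsnorm (x + y) <= hsnorm x + hsnorm y.
Proof.
rewrite -ler_sqr ?nnegrE ?addr_ge0 ?hsnorm_ge0//.
rewrite sqrrD !hsnorm_sqr innerDr.
have innerC u v : inner u v = inner v u :> R.
  by apply: eq_bigr => i _; rewrite mulrC.
rewrite (innerC _ (x + y) x) (innerC _ (x + y) y) !innerDr (innerC _ y x).
have := inner_le_hsnorm x y; lra.
Qed.

Lemma hsnormZ d (a : R) (x : 'cV[R]_d) : hsnorm (a *: x) = `|a| * hsnorm x.
Proof.
rewrite !hsnormE; under eq_bigr do rewrite mxE exprMn.
by rewrite -mulr_sumr sqrtrM ?sqr_ge0// sqrtr_sqr.
Qed.

(** Cauchy-Schwarz on each row of [A]; summing over the rows produces the Hilbert-Schmidt norm. *)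
Lemma hsnorm_mulmx m n (A : 'M[R]_(m, n)) (x : 'cV[R]_n) :
  hsnorm (A *m x) <= hsnorm A * hsnorm x.
Proof.
rewrite -ler_sqr ?nnegrE ?mulr_ge0 ?hsnorm_ge0//.
rewrite exprMn !hsnorm_sqr sqr_sqrtr; last first.
  by apply: sumr_ge0 => i _; apply: sumr_ge0 => j _; exact: sqr_ge0.
rewrite mulr_suml; apply: ler_sum => i _; rewrite -expr2 mxE.
exact: sum_cauchy_schwarz.
Qed.

(** Squaring the sum of the [|x i 0|] gives the squared coordinates plus nonnegative cross terms. *)
Lemma hsnorm_le_sum d (x : 'cV[R]_d) : hsnorm x <= \sum_i `|x i 0|.
Proof.
rewrite hsnormE -[leRHS]ger0_norm ?sumr_ge0// -sqrtr_sqr.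
rewrite ler_wsqrtr// expr2 big_distrlr/=; apply: ler_sum => i _.
rewrite (bigD1 i)//= -normrM -expr2 ger0_norm ?sqr_ge0// lerDl.
by apply: sumr_ge0 => j _; rewrite mulr_ge0.
Qed.

End hsnorm_theory.

(** * Convexity inequalities for the power p *)

Section powR_sum.
Context (R : realType) (p : R).
Hypothesis p_ge1 : 1 <= p.

Let p_gt0 : 0 < p. Proof. exact: lt_le_trans p_ge1. Qed.

(* Young's inequality with second factor 1. *)
Lemma powR_tangent (s : R) : 0 <= s -> 1 + p * (s - 1) <= s `^ p.
Proof.
move=> s0; have [->|p1] := eqVneq p 1; first by rewrite powRr1//; lra.
have p_gt1 : 1 < p by rewrite lt_neqAle eq_sym p1.
have q0 : 0 < 1 - p^-1 by rewrite subr_gt0 invf_lt1.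
have := @conjugate_powR _ s 1 p (1 - p^-1)^-1 s0 ler01 p_gt0.
rewrite invr_gt0 => /(_ q0); rewrite invrK addrC subrK => /(_ erefl).
rewrite mulr1 powR1 mul1r => H.
have : p * s <= p * (s `^ p / p + (1 - p^-1)) by rewrite ler_pM2l.
rewrite mulrDr mulrBr mulr1 divff ?gt_eqF// mulrCA divff ?gt_eqF// mulr1; lra.
Qed.

(** The tangent at the weighted mean [a] lies below the power function; averaging the tangent values
    returns the power of [a], because the weights sum to 1. The tangent is obtained by scaling with
    [a], so a vanishing mean is treated apart. *)
Lemma powR_jensen (I : finType) (w t : I -> R) :
  (forall i, 0 <= w i) -> \sum_i w i = 1 -> (forall i, 0 <= t i) ->
  (\sum_i w i * t i) `^ p <= \sum_i w i * t i `^ p.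
Proof.
move=> w0 w1 t0; set a := \sum_i w i * t i.
have : 0 <= a by apply: sumr_ge0 => i _; exact: mulr_ge0.
rewrite le_eqVlt => /predU1P[<-|a0].
  rewrite powR0 ?gt_eqF//.
  by apply: sumr_ge0 => i _; rewrite mulr_ge0// powR_ge0.
have -> : a `^ p = \sum_i w i * (a `^ p * (1 + p * (t i / a - 1))).
  transitivity (a `^ p * ((1 - p) * (\sum_i w i) + p / a * a)).
    by rewrite w1 mulfVK ?gt_eqF//; ring.
  rewrite {4}/a !mulr_sumr -big_split mulr_sumr /=; apply: eq_bigr => i _.
  by field; rewrite gt_eqF.
apply: ler_sum => i _; apply: ler_wpM2l => //.
rewrite -[in leRHS](divfK (lt0r_neq0 a0) (t i)) mulrC.
have a_ge0 := ltW a0; rewrite powRM ?divr_ge0// ler_wpM2r ?powR_ge0//.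
by rewrite powR_tangent// divr_ge0.
Qed.

(** Jensen with equal weights 1/n, applied to n times the mean. The remaining factor 1/n is dropped,
    so the constant is n^p instead of the sharp n^(p-1). *)
Lemma powR_sum_le (I : finType) (t : I -> R) : (forall i, 0 <= t i) ->
  (\sum_i t i) `^ p <= #|I|%:R `^ p * \sum_i t i `^ p.
Proof.
move=> t0; have [I0|I0] := posnP #|I|.
  have sum0 (f : I -> R) : \sum_i f i = 0.
    by apply: big_pred0 => i; have := fintype0 i; rewrite I0.
  by rewrite !sum0 mulr0 powR0 ?gt_eqF.
set n : R := #|I|%:R; have n1 : 1 <= n by rewrite ler1n.
have n0 : 0 < n by lra.
have -> : \sum_i t i = n * \sum_i n^-1 * t i.
  by rewrite -mulr_sumr mulVKf// gt_eqF.
have n_ge0 := ltW n0.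
have mean_ge0 : 0 <= \sum_i n^-1 * t i.
  by apply: sumr_ge0 => i _; rewrite mulr_ge0// invr_ge0.
rewrite powRM//.
rewrite ler_wpM2l ?powR_ge0//.
apply: (@le_trans _ _ (\sum_i n^-1 * t i `^ p)).
  apply: powR_jensen => // [i|]; first by rewrite invr_ge0.
  by rewrite sumr_const -mulr_natl -/n divff// gt_eqF.
apply: ler_sum => i _; rewrite ler_piMl ?powR_ge0//.
by rewrite invf_le1.
Qed.

Lemma powR_hsnorm_le d (x : 'cV[R]_d) :
  hsnorm x `^ p <= d%:R `^ p * \sum_i `|x i 0| `^ p.
Proof.
apply: (@le_trans _ _ ((\sum_i `|x i 0|) `^ p)).
  by rewrite ge0_ler_powR ?nnegrE ?hsnorm_ge0 ?sumr_ge0 ?hsnorm_le_sum// ltW.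
have := @powR_sum_le 'I_d (fun i => `|x i 0|); rewrite card_ord; exact.
Qed.

End powR_sum.

(** * Absolute moments of the normal law *)

Section gaussian_moment.
Context (R : realType).
Local Notation leb := (@lebesgue_measure R).
Local Open Scope ereal_scope.

(** The Radon-Nikodym derivative of [normal_prob] and [normal_pdf] have the same integral over every
    measurable set, hence agree almost everywhere. *)
Lemma ge0_integral_normal_prob (m s : R) (f : measurableTypeR R -> \bar R) :
  (forall x, 0 <= f x) -> measurable_fun [set: measurableTypeR R] f ->
  \int[normal_prob m s]_x f x = \int[leb]_x (f x * (normal_pdf m s x)%:E).
Proof.
move=> f0 mf; have dom := @normal_prob_dominates R m s.
have mpdf : measurable_fun [set: measurableTypeR R] (fun x => (normal_pdf m s x)%:E).
  by apply/measurable_EFinP; exact: measurable_normal_pdf.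
rewrite -(Radon_Nikodym_SigmaFinite.change_of_variables dom f0 measurableT mf).
have RNint := Radon_Nikodym_SigmaFinite.f_integrable dom.
have mRN := measurable_int _ RNint.
apply: ge0_ae_eq_integral => //.
- exact: emeasurable_funM.
- exact: emeasurable_funM.
- by move=> x _; rewrite mule_ge0// Radon_Nikodym_SigmaFinite.f_ge0.
- by move=> x _; rewrite mule_ge0// lee_fin normal_pdf_ge0.
- apply: ae_eqe_mul2l; apply: integral_ae_eq => // E _ mE.
  by rewrite -Radon_Nikodym_SigmaFinite.f_integral.
Qed.

(** Since |x|^p <= exp(p |x|), the integrand is dominated by a multiple of the normal density with
    doubled standard deviation, which integrates to 1. *)
Lemma normal_abs_moment_lty (s p : R) : (0 < s)%R -> (1 <= p)%R ->
  \int[normal_prob 0 s]_x (`|x| `^ p)%:E < +oo.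
Proof.
move=> s0 p1; have mpow : measurable_fun [set: measurableTypeR R] (fun x : R => (`|x| `^ p)%R).
  apply: (measurableT_comp (measurable_powR p)).
  exact: normr_measurable.
rewrite ge0_integral_normal_prob; last 2 first.
- by move=> x; rewrite lee_fin powR_ge0.
- exact/measurable_EFinP.
(* [K] is chosen so that p y - y^2 / (2 s^2) <= K - y^2 / (8 s^2): the gap is a sum of squares. The
   constant [c] also includes the ratio of the two normalising factors. *)
set K := (2 * p ^+ 2 * s ^+ 2)%R.
have s20 : (2 * s != 0)%R by rewrite mulf_neq0// gt_eqF.
set c := (expR K * normal_peak s / normal_peak (2 * s))%R.
have c0 : (0 <= c)%R.
  by rewrite divr_ge0 ?mulr_ge0 ?expR_ge0 ?normal_peak_ge0.
have bnd (x : R) : (`|x| `^ p * normal_pdf 0 s x <= c * normal_pdf 0 (2 * s) x)%R.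
  rewrite !normal_pdfE ?gt_eqF//; last by rewrite mulr_gt0.
  rewrite mulrCA [leRHS]mulrA divfK ?gt_eqF ?normal_peak_gt0//.
  rewrite [leRHS]mulrAC [leRHS]mulrC ler_wpM2l ?normal_peak_ge0//.
  rewrite /normal_fun -expRD.
  have absx : (`|x| <= expR `|x|)%R.
    by have := expR_ge1Dx `|x|%R; lra.
  apply: (@le_trans _ _ (expR (`|x| * p) * expR (- (x - 0) ^+ 2 / (s ^+ 2 *+ 2)))%R).
    rewrite ler_wpM2r ?expR_ge0// expRM ge0_ler_powR ?nnegrE ?expR_ge0//; lra.
  rewrite -expRD ler_expR subr0 -(real_normK (num_real x)).
  move: (`|x| : R)%R => y; rewrite /K -[(s ^+ 2 *+ 2)%R]mulr_natr -[((2 * s) ^+ 2 *+ 2)%R]mulr_natr.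
  have -> : (y * p + - y ^+ 2 / (s ^+ 2 * 2) =
    2 * p ^+ 2 * s ^+ 2 + - y ^+ 2 / ((2 * s) ^+ 2 * 2)
    - (3 * y ^+ 2 / (8 * s ^+ 2) - p * y + 2 * p ^+ 2 * s ^+ 2))%R.
    by field; rewrite gt_eqF.
  rewrite gerBl.
  have -> : (3 * y ^+ 2 / (8 * s ^+ 2) - p * y + 2 * p ^+ 2 * s ^+ 2 =
    (y / (2 * s) - p * s) ^+ 2 + (y / s) ^+ 2 / 8 + (p * s) ^+ 2)%R.
    by field; rewrite gt_eqF.
  by rewrite !addr_ge0 ?divr_ge0 ?sqr_ge0.
apply: (@le_lt_trans _ _ (\int[leb]_x (c%:E * (normal_pdf 0 (2 * s) x)%:E))).
  apply: ge0_le_integral => //=.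
  - by move=> x _; rewrite mule_ge0 ?lee_fin ?powR_ge0 ?normal_pdf_ge0.
  - apply: emeasurable_funM; first exact/measurable_EFinP.
    by apply/measurable_EFinP; exact: measurable_normal_pdf.
  - apply: emeasurable_funM => //.
    by apply/measurable_EFinP; exact: measurable_normal_pdf.
  - by move=> x _; rewrite -!EFinM lee_fin.
rewrite ge0_integralZl//; last 2 first.
- by apply/measurable_EFinP; exact: measurable_normal_pdf.
- by move=> x _; rewrite lee_fin normal_pdf_ge0.
by rewrite integral_normal_pdf mule1 ltry.
Qed.

End gaussian_moment.

(** * Integration against a law, and measurability of the norm *)

Section law.
Context d d' (T : measurableType d) (U : measurableType d') (R : realType).
Local Open Scope ereal_scope.

(** This serves the projections of the product space, the Gaussian increments and the identically
    distributed initial data. *)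
Lemma ge0_integral_law (P : {measure set T -> \bar R})
    (mu : {measure set U -> \bar R}) (Z : T -> U) (f : U -> \bar R) :
  measurable_fun setT Z -> measurable_fun setT f -> (forall u, 0 <= f u) ->
  (forall A, measurable A -> P (Z @^-1` A) = mu A) ->
  \int[P]_w f (Z w) = \int[mu]_u f u.
Proof.
move=> mZ mf f0 PZ.
rewrite -(@eq_measure_integral _ _ _ setT mu (pushforward P Z)); last first.
  by move=> A mA _; rewrite -PZ.
by rewrite (ge0_integral_pushforward mZ)//= preimage_setT.
Qed.

End law.

Section matrix_measurability.
Context (R : realType).

Lemma measurable_coord m n i j :
  measurable_fun setT (fun A : 'M[R]_(m, n) => A i j).
Proof.
apply: (measurability _ (RGenOpens.measurableE R)).
move=> _ [_ [a [b ->] <-]]; rewrite setTI; apply: sub_sigma_algebra.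
by apply: open_comp; [move=> x _; exact: coord_continuous|exact: interval_open].
Qed.

(** Measurability is asked coordinate by coordinate because that is how it is checked for a
    difference of two vectors on a product space. *)
Lemma measurable_hsnorm_comp d (T : measurableType d) k (g : T -> 'cV[R]_k) :
  (forall i, measurable_fun setT (fun w => g w i 0)) ->
  measurable_fun setT (fun w => hsnorm (g w)).
Proof.
move=> mg; under eq_fun do rewrite hsnormE.
apply: (@measurableT_comp _ _ _ _ _ _ (@Num.sqrt R)).
  by apply: continuous_measurable_fun; exact: sqrt_continuous.
by apply: measurable_sum => i; exact: measurable_funX.
Qed.

Lemma measurable_hsnorm k : measurable_fun setT (@hsnorm R k 1).
Proof. by apply: measurable_hsnorm_comp => i; exact: measurable_coord. Qed.

End matrix_measurability.

(** * Empirical measures and their distance to the Dirac mass at 0 *)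

Section wasserstein_dirac0.
Context (R : realType) (d : nat).
Local Open Scope ereal_scope.
Implicit Types mu : probability 'cV[R]_d R.

Lemma ge0_integral_empirical N (x : 'I_N.+1 -> 'cV[R]_d) (f : 'cV[R]_d -> \bar R) :
  measurable_fun setT f -> (forall u, 0 <= f u) ->
  \int[empirical x]_u f u = (N.+1%:R^-1)%:E * \sum_j f (x j).
Proof.
move=> mf f0.
rewrite (@eq_measure_integral _ _ _ setT
  (mscale ((N.+1%:R^-1)%:nng)%R (msum (fun k => \d_(x (inord k))) N.+1))); last first.
  move=> A mA _; rewrite /empirical /mscale /msum /=; congr (_ * _).
  by apply: eq_bigr => j _; rewrite inord_val.
rewrite ge0_integral_mscale// ge0_integral_measure_sum//; congr (_ * _).
by apply: eq_bigr => j _; rewrite integral_dirac// diracT mul1e inord_val.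
Qed.

Lemma integral_empirical_hsnorm N (x : 'I_N.+1 -> 'cV[R]_d) :
  \int[empirical x]_u (hsnorm u)%:E = (N.+1%:R^-1 * \sum_j hsnorm (x j))%:E.
Proof.
rewrite ge0_integral_empirical ?EFinM ?sumEFin//.
- by apply/measurable_EFinP; exact: measurable_hsnorm.
- by move=> u; rewrite lee_fin hsnorm_ge0.
Qed.

Lemma finite_first_moment_empirical N (x : 'I_N.+1 -> 'cV[R]_d) :
  finite_first_moment (empirical x).
Proof. by rewrite /finite_first_moment integral_empirical_hsnorm ltry. Qed.

Lemma integral_dirac0_hsnorm :
  \int[\d_(0 : 'cV[R]_d)%R]_u (hsnorm u)%:E = 0.
Proof.
rewrite integral_dirac//; first by rewrite hsnorm0 mule0.
by apply/measurable_EFinP; exact: measurable_hsnorm.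
Qed.

(** The product of [mu] with the Dirac mass is a coupling, and by Tonelli its cost is the first
    moment of [mu]. *)
Lemma wasserstein1_dirac0_le mu :
  wasserstein1 mu (\d_(0 : 'cV[R]_d)%R) <= \int[mu]_u (hsnorm u)%:E.
Proof.
apply: ereal_inf_lbound.
exists (mu \x \d_(0 : 'cV[R]_d)%R).
  move=> A mA; split.
    rewrite [LHS]product_measure1E//= -[RHS]mule1; congr (_ * _).
    exact: diracT.
  rewrite [LHS]product_measure1E//= -[RHS]mul1e; congr (_ * _).
  exact: probability_setT.
have mf : measurable_fun setT
    (fun z : 'cV[R]_d * 'cV[R]_d => (hsnorm (z.1 - z.2)%R)%:E).
  apply/measurable_EFinP; apply: measurable_hsnorm_comp => i.
  under eq_fun do rewrite !mxE.
  apply: measurable_funB.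
  - exact: (measurableT_comp (measurable_coord i 0%R) measurable_fst).
  - exact: (measurableT_comp (measurable_coord i 0%R) measurable_snd).
rewrite fubini_tonelli1//=; last by move=> z; rewrite lee_fin hsnorm_ge0.
apply: eq_integral => u _; rewrite /fubini_F integral_dirac//.
  by rewrite diracT mul1e subr0.
by apply: (measurable_comp measurableT _ mf) => //; exact: pair1_measurable.
Qed.

End wasserstein_dirac0.

(** * Pathwise estimate for one implicit step *)

Section implicit_step.
Context (R : realType) (d m1 m2 : nat).
Variables (b : 'cV[R]_d -> probability 'cV[R]_d R -> 'cV[R]_d)
  (sigma : 'cV[R]_d -> probability 'cV[R]_d R -> 'M[R]_(d, m1))
  (sigmab : 'cV[R]_d -> probability 'cV[R]_d R -> 'M[R]_(d, m2))
  (sigma0 sigma1 lambda1 lambda2 l0 Lhat : R) (phi : R -> R).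
Hypotheses (lambda1_gt0 : 0 < lambda1) (lambda2_gt0 : 0 < lambda2)
  (lambda12 : 2 * lambda2 < lambda1) (l0_ge1 : 1 <= l0) (Lhat_gt0 : 0 < Lhat).
Hypothesis phi_ge0 : forall r : R, 0 <= r -> 0 <= phi r.
Hypothesis phi_incr : forall r s : R, 0 <= r -> r <= s -> phi r <= phi s.
Hypothesis b_diss : forall (x y : 'cV[R]_d) mu, finite_first_moment mu ->
  inner (x - y) (b x mu - b y mu) <=
    hsnorm (x - y) * phi (hsnorm (x - y)) * (hsnorm (x - y) <= l0)%R%:R
    - lambda1 * hsnorm (x - y) ^+ 2 * (l0 < hsnorm (x - y))%R%:R.
Hypothesis b_lip : forall (x : 'cV[R]_d) mu nu,
  finite_first_moment mu -> finite_first_moment nu ->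
  ((hsnorm (b x mu - b x nu))%:E <= lambda2%:E * wasserstein1 mu nu)%E.
Hypothesis sigma_bound : forall (x : 'cV[R]_d) mu, finite_first_moment mu ->
  Num.max (hsnorm (sigma x mu)) (hsnorm (sigmab x mu)) <= Lhat.

Local Notation mean N x := (N.+1%:R^-1 * \sum_(j < N.+1) hsnorm (x j : 'cV[R]_d)).

Definition drift_at0 : R := hsnorm (b 0 \d_(0 : 'cV[R]_d)).

(** This is the constant D. Inside the ball of radius [l0] no dissipation is available:
    [l0 * phi l0] bounds the growth there, and [lambda1 * l0 ^+ 2] pays for subtracting
    [lambda1 * hsnorm y ^+ 2] all the same. *)
Definition drift_cst : R := l0 * phi l0 + lambda1 * l0 ^+ 2.

Lemma drift_cst_ge0 : 0 <= drift_cst.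
Proof.
have l0_ge0 : 0 <= l0 by exact: le_trans l0_ge1.
by rewrite addr_ge0 ?mulr_ge0 ?phi_ge0 ?sqr_ge0// ltW.
Qed.

Lemma drift_at0_empirical N (x : 'I_N.+1 -> 'cV[R]_d) :
  hsnorm (b 0 (empirical x)) <= drift_at0 + lambda2 * mean N x.
Proof.
have : ((hsnorm (b 0 (empirical x) - b 0 \d_(0 : 'cV[R]_d)))%:E
    <= (lambda2 * mean N x)%:E)%E.
  apply: le_trans (b_lip _ _ _) _.
  - exact: finite_first_moment_empirical.
  - by rewrite /finite_first_moment integral_dirac0_hsnorm ltry.
  - rewrite EFinM lee_pmul2l ?lte_fin// -integral_empirical_hsnorm.
    exact: wasserstein1_dirac0_le.
rewrite lee_fin => bnd; rewrite -[b 0 (empirical x)](subrK (b 0 \d_(0 : 'cV[R]_d))).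
by rewrite (le_trans (hsnormD _ _))// addrC lerD2l.
Qed.

(** Dissipativity is applied to the pair y, 0; the remaining drift at 0 is paired with y by
    Cauchy-Schwarz. *)
Lemma inner_drift_le N (x : 'I_N.+1 -> 'cV[R]_d) (y : 'cV[R]_d) :
  inner y (b y (empirical x)) <=
  drift_cst - lambda1 * hsnorm y ^+ 2 + hsnorm y * (drift_at0 + lambda2 * mean N x).
Proof.
have y0 := hsnorm_ge0 y.
have := b_diss y 0 (finite_first_moment_empirical x); rewrite !subr0 => diss.
have {}diss : inner y (b y (empirical x) - b 0 (empirical x)) <=
    drift_cst - lambda1 * hsnorm y ^+ 2.
  apply: le_trans diss _; rewrite /drift_cst.
  case: (leP (hsnorm y) l0) => yl0; rewrite mulr1 mulr0.
    rewrite subr0 -[leLHS]addr0 -addrA lerD//.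
      by rewrite ler_pM// ?phi_ge0// phi_incr.
    by rewrite -mulrBr mulr_ge0 ?(ltW lambda1_gt0)// subr_ge0 ler_sqr// nnegrE; lra.
  by rewrite sub0r lerDr; exact: drift_cst_ge0.
rewrite -[b y (empirical x)](subrK (b 0 (empirical x))) innerDr lerD//.
apply: (le_trans (inner_le_hsnorm _ _)).
by rewrite ler_wpM2l// drift_at0_empirical.
Qed.

(** A larger y would give a y (y - A/a) >= (1 + D)^2 > D. The coefficient of A stays exactly 1/a, as
    the contraction requires; all the loss is additive. *)
Lemma quadratic_root_le (a y A D : R) : 1 <= a -> 0 <= y -> 0 <= A -> 0 <= D ->
  a * y ^+ 2 <= y * A + D -> y <= A / a + 1 + D.
Proof.
move=> a1 y0 A0 D0 quad; rewrite leNgt; apply/negP => yA.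
have a0 : 0 < a by lra.
have A'0 : 0 <= A / a by rewrite divr_ge0// ltW.
have AE : A = a * (A / a) by rewrite mulrCA divff ?mulr1// gt_eqF.
move: (A / a) AE A'0 yA => A' AE A'0 yA.
have : (1 + D) * (1 + D) <= y * (y - A') by rewrite ler_pM//; lra.
have : 1 * (y * (y - A')) <= a * (y * (y - A')).
  by rewrite ler_wpM2r// mulr_ge0//; lra.
by move: quad; rewrite AE; nra.
Qed.

Variables (h p : R).
Hypotheses (h_gt0 : 0 < h) (h_le1 : h <= 1) (p_ge1 : 1 <= p).

Definition weight_self : R := (1 + lambda1 * h)^-1.
Definition weight_mean : R := lambda2 * h / (1 + lambda1 * h).
Definition contraction : R := weight_self + weight_mean.

Let denom_gt1 : 1 < 1 + lambda1 * h.
Proof. by rewrite ltrDl mulr_gt0. Qed.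

Let denom_gt0 : 0 < 1 + lambda1 * h.
Proof. exact: lt_trans denom_gt1. Qed.

Lemma weight_self_ge0 : 0 <= weight_self.
Proof. by rewrite invr_ge0 ltW. Qed.

Lemma weight_mean_ge0 : 0 <= weight_mean.
Proof. by rewrite divr_ge0 ?mulr_ge0// ltW. Qed.

Lemma contraction_ge0 : 0 <= contraction.
Proof. by rewrite addr_ge0 ?weight_self_ge0 ?weight_mean_ge0. Qed.

Lemma contractionE : contraction = (1 + lambda2 * h) / (1 + lambda1 * h).
Proof. by rewrite mulrDl mul1r. Qed.

Lemma contraction_lt1 : contraction < 1.
Proof. rewrite contractionE ltr_pdivrMr// mul1r ltrD2l ltr_pM2r//.
by move: lambda12 lambda2_gt0; lra. Qed.

(** Through 1 - g h <= exp(- g h). Clearing denominators reduces the claim to g (1 + lambda1 h) <=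
    lambda1 - lambda2, which for h <= 1 follows from g (1 + lambda1) <= lambda1 - lambda2. *)
Lemma contraction_le_expR :
  contraction <= expR (- ((lambda1 - 2 * lambda2)
    / (2 + 3 * (2 * lambda1 - 3 * lambda2))) * h).
Proof.
set den := 2 + 3 * (2 * lambda1 - 3 * lambda2).
have den_gt0 : 0 < den by rewrite /den; move: lambda12 lambda2_gt0; lra.
set g := _ / den.
apply: le_trans (expR_ge1Dx _); rewrite contractionE ler_pdivrMr//.
have gdef : g * den = lambda1 - 2 * lambda2 by rewrite divfK// gt_eqF.
have g_ge0 : 0 <= g by rewrite divr_ge0 ?(ltW den_gt0)// subr_ge0 ltW.
have gh : g * (1 + lambda1 * h) <= lambda1 - lambda2.
  apply: (@le_trans _ _ (g * (1 + lambda1))).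
    by rewrite ler_wpM2l// lerD2l ler_piMr// ltW.
  rewrite -(ler_pM2r den_gt0) mulrAC gdef /den.
  by move: lambda12 lambda2_gt0; nra.
rewrite -subr_ge0.
have -> : (1 + - g * h) * (1 + lambda1 * h) - (1 + lambda2 * h) =
  h * (lambda1 - lambda2 - g * (1 + lambda1 * h)) by ring.
by rewrite mulr_ge0 ?(ltW h_gt0)// subr_ge0.
Qed.

Definition step_offset : R := h * drift_at0 + 1 + h * drift_cst.

Lemma step_offset_ge0 : 0 <= step_offset.
Proof.
by rewrite !addr_ge0 ?mulr_ge0 ?hsnorm_ge0 ?drift_cst_ge0 ?(ltW h_gt0).
Qed.

Lemma implicit_step_le N (x : 'I_N.+1 -> 'cV[R]_d) i (y z : 'cV[R]_d) :
  y = x i + h *: b y (empirical x) + z ->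
  hsnorm y <= weight_self * hsnorm (x i) + weight_mean * mean N x
    + (hsnorm z + step_offset).
Proof.
move=> yE; set m := mean N x.
have m_ge0 : 0 <= m.
  by rewrite mulr_ge0 ?invr_ge0// sumr_ge0// => j _; exact: hsnorm_ge0.
have [K0 D0] : 0 <= drift_at0 /\ 0 <= drift_cst.
  by split; [exact: hsnorm_ge0|exact: drift_cst_ge0].
have [x0 z0] : 0 <= hsnorm (x i) /\ 0 <= hsnorm z by split; exact: hsnorm_ge0.
pose A := hsnorm (x i) + hsnorm z + h * (drift_at0 + lambda2 * m).
have A0 : 0 <= A.
  by rewrite !addr_ge0// mulr_ge0 ?(ltW h_gt0)// addr_ge0// mulr_ge0// ltW.
have quad : (1 + lambda1 * h) * hsnorm y ^+ 2 <= hsnorm y * A + h * drift_cst.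
  have : hsnorm y ^+ 2 <= hsnorm y * hsnorm (x i)
      + h * (drift_cst - lambda1 * hsnorm y ^+ 2 + hsnorm y * (drift_at0 + lambda2 * m))
      + hsnorm y * hsnorm z.
    (* Only the second factor of <y, y> is replaced by the implicit equation, so that the drift
       occurs as <y, b(y, mu)>. *)
    rewrite [leLHS]hsnorm_sqr {2}yE !innerDr innerZr.
    rewrite lerD ?inner_le_hsnorm// lerD ?inner_le_hsnorm//.
    by rewrite ler_wpM2l ?inner_drift_le// ltW.
  rewrite /A; lra.
have := quadratic_root_le (ltW denom_gt1) (hsnorm_ge0 y) A0 _ quad.
move=> /(_ (mulr_ge0 (ltW h_gt0) D0)) /le_trans; apply.
rewrite /weight_self /weight_mean /step_offset -/m /A.
(* The division by [1 + lambda1 * h] is given up for the noise and the constant only; on |X^i| and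
   the mean it forms the two weights. *)
have shrink u : 0 <= u -> u / (1 + lambda1 * h) <= u.
  by move=> u0; rewrite ler_piMr// invf_le1// ltW.
have hz := shrink _ z0; have hK := shrink _ (mulr_ge0 (ltW h_gt0) K0).
set v := (1 + lambda1 * h)^-1 in hz hK *; lra.
Qed.

(** This is Q = (1 - rho)^(1 - p), what remains of the weight 1 - rho put on G / (1 - rho). *)
Definition noise_factor : R := (1 - contraction) * ((1 - contraction)^-1 `^ p).

Lemma noise_factor_ge0 : 0 <= noise_factor.
Proof. by rewrite mulr_ge0 ?powR_ge0// subr_ge0 ltW// contraction_lt1. Qed.

Lemma powR_implicit_step_le N (x : 'I_N.+1 -> 'cV[R]_d) i (y z : 'cV[R]_d) :
  y = x i + h *: b y (empirical x) + z ->
  hsnorm y `^ p <= weight_self * hsnorm (x i) `^ p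
    + weight_mean * (N.+1%:R^-1 * \sum_j hsnorm (x j) `^ p)
    + noise_factor * (hsnorm z + step_offset) `^ p.
Proof.
move=> yE; have := implicit_step_le yE; set m := mean N x.
set G := hsnorm z + _ => step.
have p_gt0 : 0 < p by exact: lt_le_trans p_ge1.
have p_ge0 := ltW p_gt0.
have q_gt0 : 0 < 1 - contraction by rewrite subr_gt0 contraction_lt1.
have m_ge0 : 0 <= m.
  by rewrite mulr_ge0 ?invr_ge0// sumr_ge0// => j _; exact: hsnorm_ge0.
have G_ge0 : 0 <= G.
  by rewrite addr_ge0 ?hsnorm_ge0 ?step_offset_ge0.
have m_jensen : m `^ p <= N.+1%:R^-1 * \sum_j hsnorm (x j) `^ p.
  rewrite /m !mulr_sumr; apply: powR_jensen => // [|j].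
  - by rewrite sumr_const card_ord -[LHS]mulr_natl divff// pnatr_eq0.
  - exact: hsnorm_ge0.
(* The third point is divided by its own weight, so that the convex combination is the bound of the
   step itself. *)
pose w (k : 'I_3) := nth 0 [:: weight_self; weight_mean; 1 - contraction] k.
pose t (k : 'I_3) := nth 0 [:: hsnorm (x i); m; G / (1 - contraction)] k.
have jensen := @powR_jensen R p p_ge1 _ w t.
rewrite !big_ord_recl !big_ord0 /w /t /= !addr0 !addrA in jensen.
rewrite [(1 - contraction) * (G / _)]mulrCA divff ?gt_eqF// mulr1 in jensen.
apply: (@le_trans _ _ ((weight_self * hsnorm (x i) + weight_mean * m + G) `^ p)).
  by rewrite ge0_ler_powR// nnegrE ?(le_trans (hsnorm_ge0 y) step) ?hsnorm_ge0.
apply: le_trans (jensen _ _ _) _.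
- move=> [[|[|[|k]]] ?] //=; first exact: weight_self_ge0.
    exact: weight_mean_ge0.
  exact: ltW.
- by rewrite /contraction; ring.
- move=> [[|[|[|k]]] ?] //=; first exact: hsnorm_ge0.
  exact: divr_ge0 G_ge0 (ltW q_gt0).
rewrite lerD//; first by rewrite lerD2l ler_wpM2l ?weight_mean_ge0.
by rewrite powRM ?invr_ge0 ?(ltW q_gt0)// [G `^ p * _]mulrC mulrA.
Qed.

Definition abs_moment_sum k (v : 'cV[R]_k) : R := \sum_j `|v j 0| `^ p.

(** Being affine with nonnegative coefficients, the same formula serves pathwise and in expectation.
    The 5 counts the offset and the four noise terms. *)
Definition noise_moment_bound (u1 u2 u3 u4 : R) : R :=
  noise_factor * (5%:R `^ p *
    (step_offset `^ p
     + `|sigma0| `^ p * (d%:R `^ p * u1) + Lhat `^ p * (m1%:R `^ p * u2)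
     + `|sigma1| `^ p * (d%:R `^ p * u3) + Lhat `^ p * (m2%:R `^ p * u4))).

Lemma powR_bem_step_le N (x : 'I_N.+1 -> 'cV[R]_d) i (y : 'cV[R]_d)
    (v1 v3 : 'cV[R]_d) (v2 : 'cV[R]_m1) (v4 : 'cV[R]_m2) :
  y = x i + h *: b y (empirical x) + sigma0 *: v1
      + sigma (x i) (empirical x) *m v2 + sigma1 *: v3
      + sigmab (x i) (empirical x) *m v4 ->
  hsnorm y `^ p <= weight_self * hsnorm (x i) `^ p
    + weight_mean * (N.+1%:R^-1 * \sum_j hsnorm (x j) `^ p)
    + noise_moment_bound (abs_moment_sum v1) (abs_moment_sum v2)
        (abs_moment_sum v3) (abs_moment_sum v4).
Proof.
have p_ge0 : 0 <= p by exact: le_trans p_ge1.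
have Lhat_ge0 := ltW Lhat_gt0.
set z1 := sigma0 *: v1; set z2 := sigma _ _ *m v2; set z3 := sigma1 *: v3.
set z4 := sigmab _ _ *m v4 => yE.
have {}yE : y = x i + h *: b y (empirical x) + (z1 + z2 + z3 + z4).
  by rewrite !addrA.
apply: (le_trans (powR_implicit_step_le yE)); rewrite lerD2l.
rewrite ler_wpM2l ?noise_factor_ge0//.
have mono (u v : R) : 0 <= u -> u <= v -> u `^ p <= v `^ p.
  by move=> u0 uv; rewrite ge0_ler_powR ?nnegrE// (le_trans u0).
have := sigma_bound (x i) (finite_first_moment_empirical x).
rewrite ge_max => /andP[sigma_le sigmab_le].
have powZ k (c : R) (v : 'cV[R]_k) (u : R) : 0 <= c -> 0 <= u ->
    u <= c * hsnorm v -> u `^ p <= c `^ p * (k%:R `^ p * abs_moment_sum v).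
  move=> c0 u0 ucv; apply: (le_trans (mono _ _ u0 ucv)).
  by rewrite powRM ?hsnorm_ge0// ler_wpM2l ?powR_ge0 ?powR_hsnorm_le.
pose t (k : 'I_5) := nth 0 [:: step_offset; hsnorm z1; hsnorm z2; hsnorm z3; hsnorm z4] k.
have sum_le := @powR_sum_le R p p_ge1 _ t.
rewrite card_ord !big_ord_recl !big_ord0 /t /= !addr0 in sum_le.
apply: (@le_trans _ _ ((step_offset + (hsnorm z1 + (hsnorm z2 + (hsnorm z3 + hsnorm z4)))) `^ p)).
  apply: mono; first by rewrite addr_ge0 ?hsnorm_ge0 ?step_offset_ge0.
  rewrite addrC lerD2l (le_trans (hsnormD _ _))// !addrA lerD2r.
  rewrite (le_trans (hsnormD _ _))// lerD2r; exact: hsnormD.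
apply: le_trans (sum_le _) _.
  by move=> [[|[|[|[|[|k]]]]] ?] //=; rewrite ?hsnorm_ge0 ?step_offset_ge0.
rewrite ler_wpM2l ?powR_ge0// !addrA !lerD//; apply: powZ;
  rewrite ?normr_ge0 ?hsnorm_ge0 ?hsnormZ//.
- by rewrite (le_trans (hsnorm_mulmx _ _))// ler_wpM2r// hsnorm_ge0.
- by rewrite (le_trans (hsnorm_mulmx _ _))// ler_wpM2r// hsnorm_ge0.
Qed.

End implicit_step.

(** * Bounds on expectations and their lifting to the product space *)

Section mean_le.
Context (disp : measure_display) (T : measurableType disp) (R : realType).
Implicit Types (P : probability T R) (f g : T -> R) (s t : R).

(** Measurability and nonnegativity travel with the bound, so that sums and multiples need no
    integrability side conditions. *)
Definition mean_le P f s : Prop :=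
  [/\ measurable_fun [set: T] f, forall w, 0 <= f w &
      (\int[P]_w (f w)%:E <= s%:E)%E].

Lemma mean_le_cst P s : 0 <= s -> mean_le P (fun=> s) s.
Proof.
by move=> s0; split=> //; rewrite integral_cst//= probability_setT mule1.
Qed.

Lemma mean_leD P f g s t : mean_le P f s -> mean_le P g t ->
  mean_le P (fun w => f w + g w) (s + t).
Proof.
move=> [mf f0 fs] [mg g0 gt]; split.
- exact: measurable_funD.
- by move=> w; rewrite addr_ge0.
under eq_integral do rewrite EFinD.
rewrite ge0_integralD//; first by rewrite EFinD leeD.
- by move=> w _; rewrite lee_fin.
- exact/measurable_EFinP.
- by move=> w _; rewrite lee_fin.
- exact/measurable_EFinP.
Qed.

Lemma mean_leZ P (c : R) f s : 0 <= c -> mean_le P f s ->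
  mean_le P (fun w => c * f w) (c * s).
Proof.
move=> c0 [mf f0 fs]; split.
- exact: measurable_funM.
- by move=> w; rewrite mulr_ge0.
under eq_integral do rewrite EFinM.
rewrite ge0_integralZl//.
- by rewrite EFinM lee_pmul// ?lee_fin// integral_ge0// => w _; rewrite lee_fin.
- exact/measurable_EFinP.
- by move=> w _; rewrite lee_fin.
Qed.

Lemma mean_le_sum P (I : finType) (f : I -> T -> R) s :
  (forall i, mean_le P (f i) s) ->
  mean_le P (fun w => \sum_i f i w) (#|I|%:R * s).
Proof.
move=> fs; split.
- by apply: measurable_sum => i; case: (fs i).
- by move=> w; apply: sumr_ge0 => i _; case: (fs i).
under eq_integral do rewrite -sumEFin.
rewrite ge0_integral_sum//.
- rewrite mulr_natl -sumr_const -sumEFin; apply: lee_sum => i _.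
  by case: (fs i).
- by move=> i; apply/measurable_EFinP; case: (fs i).
- by move=> i w _; rewrite lee_fin; case: (fs i).
Qed.

(** This is the form needed for the scheme, whose equation holds almost surely only. *)
Lemma mean_le_ae P f g s : measurable_fun [set: T] f -> (forall w, 0 <= f w) ->
  {ae P, forall w, f w <= g w} -> mean_le P g s -> mean_le P f s.
Proof.
move=> mf f0 fg [mg g0 gs]; split=> //; apply: le_trans gs.
apply: ae_ge0_le_integral => //.
- by move=> w _; rewrite lee_fin.
- exact/measurable_EFinP.
- by move=> w _; rewrite lee_fin.
- exact/measurable_EFinP.
- by apply: filterS fg => w fg _; rewrite lee_fin.
Qed.

End mean_le.

Section mean_le_product.
Context (d1 d2 : measure_display) (T1 : measurableType d1)
  (T2 : measurableType d2) (R : realType)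
  (P1 : probability T1 R) (P2 : probability T2 R).

Lemma product_measure_fst A : measurable A ->
  (P1 \x P2)%E (fst @^-1` A) = P1 A.
Proof.
move=> mA; have -> : fst @^-1` A = A `*` [set: T2].
  by apply/seteqP; split => [[x y]|[x y] []].
rewrite [LHS]product_measure1E// -[RHS]mule1; congr (_ * _)%E.
exact: probability_setT.
Qed.

Lemma product_measure_snd A : measurable A ->
  (P1 \x P2)%E (snd @^-1` A) = P2 A.
Proof.
move=> mA; have -> : snd @^-1` A = [set: T1] `*` A.
  by apply/seteqP; split => [[x y]|[x y] []].
rewrite [LHS]product_measure1E// -[RHS]mul1e; congr (_ * _)%E.
exact: probability_setT.
Qed.

Lemma mean_le_fst f s : mean_le P1 f s ->
  mean_le (P1 \x P2)%E (fun w => f w.1) s.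
Proof.
move=> [mf f0 fs]; split=> //.
  exact: (measurableT_comp mf measurable_fst).
rewrite (@ge0_integral_law _ _ _ _ _ _ P1 fst (EFin \o f))//.
- exact/measurable_EFinP.
- exact: product_measure_fst.
Qed.

Lemma mean_le_snd f s : mean_le P2 f s ->
  mean_le (P1 \x P2)%E (fun w => f w.2) s.
Proof.
move=> [mf f0 fs]; split=> //.
  exact: (measurableT_comp mf measurable_snd).
rewrite (@ge0_integral_law _ _ _ _ _ _ P2 snd (EFin \o f))//.
- exact/measurable_EFinP.
- exact: product_measure_snd.
Qed.

End mean_le_product.

(** * Moments of Brownian increments *)

Section brownian_increment.
Context (R : realType) (disp : measure_display) (O : measurableType disp)
  (P : probability O R) (F : R -> set_system O) (k : nat)
  (B : R -> O -> 'cV[R]_k).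
Hypotheses (usualF : usual_conditions P F) (BM : brownian_motion P F B).

Lemma measurable_brownian t : 0 <= t -> measurable_fun [set: O] (B t).
Proof.
move=> t0 _ A mA; rewrite setTI.
by apply: (usual_measurable usualF t0); exact: (brownian_adapted BM).
Qed.

Lemma measurable_brownian_increment s t j : 0 <= s -> s < t ->
  measurable_fun [set: O] (fun w => (B t w - B s w) j 0).
Proof.
move=> s0 st; under eq_fun do rewrite !mxE.
have t0 := le_trans s0 (ltW st).
apply: measurable_funB.
- exact: (measurableT_comp (measurable_coord j 0) (measurable_brownian t0)).
- exact: (measurableT_comp (measurable_coord j 0) (measurable_brownian s0)).
Qed.

Lemma brownian_increment_law s t j (A : set R) : 0 <= s -> s < t ->
  measurable A ->
  P ((fun w => (B t w - B s w) j 0) @^-1` A) = normal_prob 0 (Num.sqrt (t - s)) A.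
Proof.
move=> s0 st mA; have st0 : 0 <= s < t by rewrite s0 st.
(* The marginal law comes from a box with side [A] in direction [j] and the whole line in all
   others. *)
pose A' (i : 'I_k) : set R := if i == j then A else setT.
have mA' i : measurable (A' i) by rewrite /A'; case: ifP.
transitivity (P [set w | forall i, A' i ((B t w - B s w) i 0)]).
  congr (P _); apply/seteqP; split => w /=.
    by move=> Aw i; rewrite /A'; case: eqP => // ->.
  by move=> /(_ j); rewrite /A' eqxx.
rewrite (brownian_gaussian BM st0 mA') (bigD1 j)//= big1 ?mule1.
  by rewrite /A' eqxx.
move=> i ij; rewrite /A' (negbTE ij); exact: probability_setT.
Qed.

Lemma mean_le_brownian_increment s t p : 0 <= s -> s < t -> 1 <= p ->
  mean_le P (fun w => abs_moment_sum p (B t w - B s w))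
    (k%:R * fine (\int[normal_prob 0 (Num.sqrt (t - s))]_x (`|x| `^ p)%:E)%E).
Proof.
move=> s0 st p1.
set M := fine _; rewrite -[k in k%:R]card_ord; apply: mean_le_sum => j.
have mZ := measurable_brownian_increment j s0 st.
have mpow : measurable_fun [set: R] (fun x : R => `|x| `^ p).
  exact: (measurableT_comp (measurable_powR p) (@normr_measurable _ _)).
split.
- exact: (measurableT_comp mpow mZ).
- by move=> w; exact: powR_ge0.
rewrite (@ge0_integral_law _ _ _ _ _ P (normal_prob 0 (Num.sqrt (t - s)))
  (fun w => (B t w - B s w) j 0) (fun x => (`|x| `^ p)%:E))//.
(* [fine] loses nothing here, since the Gaussian moment is finite. *)
- rewrite /M fineK// ge0_fin_numE.
    by rewrite normal_abs_moment_lty// sqrtr_gt0 subr_gt0.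
  by apply: integral_ge0 => x _; rewrite lee_fin powR_ge0.
- exact/measurable_EFinP.
- by move=> A mA; exact: brownian_increment_law.
Qed.

End brownian_increment.

(** * The moment recursion along the scheme *)

Theorem lemma3p1 (R : realType) (d m1 m2 : nat)
    (b : 'cV[R]_d -> probability 'cV[R]_d R -> 'cV[R]_d)
    (sigma : 'cV[R]_d -> probability 'cV[R]_d R -> 'M[R]_(d, m1))
    (sigmab : 'cV[R]_d -> probability 'cV[R]_d R -> 'M[R]_(d, m2))
    (sigma0 sigma1 lambda1 lambda2 l0 Lhat : R) (phi : R -> R)
    (b_loclip : locally_lipschitz (fun x => b x (\d_(0 : 'cV[R]_d))))
    (lambda1_gt0 : 0 < lambda1) (l0_ge1 : 1 <= l0)
    (phi_ge0 : forall r : R, 0 <= r -> 0 <= phi r)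
    (phi_incr : forall r s : R, 0 <= r -> r <= s -> phi r <= phi s)
    (phi_cont : {within [set r : R | 0 <= r], continuous phi})
    (phi0 : phi 0 = 0)
    (b_diss : forall (x y : 'cV[R]_d) mu, finite_first_moment mu ->
      inner (x - y) (b x mu - b y mu) <=
        hsnorm (x - y) * phi (hsnorm (x - y)) * (hsnorm (x - y) <= l0)%R%:R
        - lambda1 * hsnorm (x - y) ^+ 2 * (l0 < hsnorm (x - y))%R%:R)
    (lambda2_gt0 : 0 < lambda2)
    (b_lip : forall (x : 'cV[R]_d) mu nu, finite_first_moment mu -> finite_first_moment nu ->
      ((hsnorm (b x mu - b x nu))%:E <= lambda2%:E * wasserstein1 mu nu)%E)
    (Lhat_gt0 : 0 < Lhat)
    (sigma_bound : forall (x : 'cV[R]_d) mu, finite_first_moment mu ->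
      Num.max (hsnorm (sigma x mu)) (hsnorm (sigmab x mu)) <= Lhat)
    (lambda12 : 2 * lambda2 < lambda1)
    (p h : R) (p_ge1 : 1 <= p) (h_gt0 : 0 < h)
    (h_le : h <= Num.min 1
       ((lambda1 - 2 * lambda2) / (2 * p * (1 + lambda2) `^ p))) :
  exists2 C : R, 0 < C &
  forall (N : nat) (dB dW : measure_display)
    (OB : measurableType dB) (OW : measurableType dW)
    (PB : probability OB R) (PW : probability OW R)
    (FB : R -> set_system OB) (FW : R -> set_system OW)
    (B : 'I_N.+1 -> R -> OB -> 'cV[R]_d)
    (Bb : 'I_N.+1 -> R -> OB -> 'cV[R]_m1)
    (W : R -> OW -> 'cV[R]_d) (Wb : R -> OW -> 'cV[R]_m2)
    (xi : 'I_N.+1 -> OB -> 'cV[R]_d)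
    (X : nat -> 'I_N.+1 -> {RV (PB \x PW)%E >-> 'cV[R]_d}),
    usual_conditions PB FB -> usual_conditions PW FW ->
    (forall i, brownian_motion PB FB (B i)) ->
    (forall i, brownian_motion PB FB (Bb i)) ->
    brownian_motion PW FW W -> brownian_motion PW FW Wb ->
    mutually_independent (PB \x PW)%E (noise_sigma B Bb W Wb) ->
    (forall i A, measurable A -> FB 0 (xi i @^-1` A)) ->
    iid PB xi ->
    (forall i w, X 0%N i w = xi i w.1) ->
    bem_scheme b sigma sigmab sigma0 sigma1 PB PW h B Bb W Wb
      (fun n i => X n i) ->
    forall (n : nat) (i : 'I_N.+1),
      let E_p k := ('E_(PB \x PW)[fun w => (hsnorm (X k i w) `^ p)%R])%E in
      let gamma :=
        (lambda1 - 2 * lambda2) / (2 + 3 * (2 * lambda1 - 3 * lambda2)) in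
      (E_p 0%N < +oo)%E ->
      (E_p n <= (expR (- gamma * (n%:R * h)))%:E * E_p 0%N + C%:E)%E.
Proof.
have h_le1 : h <= 1 by move: h_le; rewrite le_min => /andP[].
set rho := contraction lambda1 lambda2 h.
have rho_ge0 : 0 <= rho by exact: contraction_ge0.
have rho_lt1 : rho < 1 by exact: contraction_lt1.
have rho_le := contraction_le_expR lambda1_gt0 lambda2_gt0 lambda12 h_gt0 h_le1.
have h_ge0 := ltW h_gt0; have Lhat_ge0 := ltW Lhat_gt0.
set M := fine (\int[normal_prob 0 (Num.sqrt h)]_x (`|x| `^ p)%:E)%E.
set K := noise_moment_bound m1 m2 b sigma0 sigma1 lambda1 lambda2 l0 Lhat phi h p
  (d%:R * M) (m1%:R * M) (d%:R * M) (m2%:R * M).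
have C_ge0 : 0 <= `|K| / (1 - rho) by rewrite divr_ge0// subr_ge0 ltW.
(* The quotient is the fixed point of a -> rho a + |K|; the absolute value makes it nonnegative at
   once and the added 1 makes it positive. It is fixed before the number of particles and the
   probability spaces. *)
exists (`|K| / (1 - rho) + 1); first by rewrite ltr_wpDl.
move=> N dB dW OB OW PB PW FB FW B Bb W Wb xi X usualB usualW BM BbM WM WbM _
  xi_adapted [_ xi_law] X0 scheme n i E_p gamma E_p0.
have mX k j : measurable_fun [set: OB * OW] (fun w => hsnorm (X k j w) `^ p).
  apply: (measurableT_comp (measurable_powR p)).
  exact: (measurableT_comp (@measurable_hsnorm R d) (measurable_funPT (X k j))).
have X_ge0 k j w : 0 <= hsnorm (X k j w) `^ p by exact: powR_ge0.
have E_p0_fin : (fine (E_p 0%N))%:E = E_p 0%N.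
  rewrite fineK// ge0_fin_numE// /E_p unlock integral_ge0// => w _.
  by rewrite lee_fin.
set e0 := fine (E_p 0%N).
(* The mean-field term involves all particles, so one initial bound must serve them all; identical
   distribution makes [e0] such a bound. *)
have X0_law j A : measurable A ->
    (PB \x PW)%E (X 0%N j @^-1` A) = (PB \x PW)%E (X 0%N i @^-1` A).
  move=> mA; have X0E l : X 0%N l @^-1` A = fst @^-1` (xi l @^-1` A).
    by apply/seteqP; split => w /=; rewrite X0.
  have mxi l : measurable (xi l @^-1` A).
    by apply: (usual_measurable usualB (lexx 0)); exact: xi_adapted.
  by rewrite !X0E !product_measure_fst// (xi_law j i).
have mean0 j : mean_le (PB \x PW)%E (fun w => hsnorm (X 0%N j w) `^ p) e0.
  split=> //; rewrite E_p0_fin /E_p unlock.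
  have mhs : measurable_fun [set: 'cV[R]_d] (fun u : 'cV[R]_d => (hsnorm u `^ p)%:E).
    apply/measurable_EFinP; apply: (measurableT_comp (measurable_powR p)).
    exact: measurable_hsnorm.
  rewrite (@ge0_integral_law _ _ _ _ _ _ (pushforward (PB \x PW)%E (X 0%N i))
    (X 0%N j) (fun u => (hsnorm u `^ p)%:E))//.
  - rewrite (ge0_integral_pushforward (measurable_funPT (X 0%N i)))// => u _.
    by rewrite lee_fin powR_ge0.
  - by move=> u; rewrite lee_fin powR_ge0.
  - exact: X0_law.
have time k : 0 <= k%:R * h /\ k%:R * h < k.+1%:R * h.
  by split; rewrite ?mulr_ge0// ltr_pM2r// ltr_nat.
have time_diff k : k.+1%:R * h - k%:R * h = h.
  by rewrite -mulrBl -natrB// subSnn mul1r.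
have incrB k j : mean_le (PB \x PW)%E (fun w => abs_moment_sum p
    (B j (k.+1%:R * h) w.1 - B j (k%:R * h) w.1)) (d%:R * M).
  have [s0 st] := time k.
  have := mean_le_brownian_increment usualB (BM j) s0 st p_ge1.
  by rewrite time_diff => /(@mean_le_fst _ _ _ _ _ PB PW).
have incrBb k j : mean_le (PB \x PW)%E (fun w => abs_moment_sum p
    (Bb j (k.+1%:R * h) w.1 - Bb j (k%:R * h) w.1)) (m1%:R * M).
  have [s0 st] := time k.
  have := mean_le_brownian_increment usualB (BbM j) s0 st p_ge1.
  by rewrite time_diff => /(@mean_le_fst _ _ _ _ _ PB PW).
have incrW k : mean_le (PB \x PW)%E (fun w => abs_moment_sum p
    (W (k.+1%:R * h) w.2 - W (k%:R * h) w.2)) (d%:R * M).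
  have [s0 st] := time k.
  have := mean_le_brownian_increment usualW WM s0 st p_ge1.
  by rewrite time_diff => /(@mean_le_snd _ _ _ _ _ PB PW).
have incrWb k : mean_le (PB \x PW)%E (fun w => abs_moment_sum p
    (Wb (k.+1%:R * h) w.2 - Wb (k%:R * h) w.2)) (m2%:R * M).
  have [s0 st] := time k.
  have := mean_le_brownian_increment usualW WbM s0 st p_ge1.
  by rewrite time_diff => /(@mean_le_snd _ _ _ _ _ PB PW).
(* With a bound [a] common to all particles, their mean is again bounded by [a], and the two weights
   add up to [rho]. *)
have step k a : (forall j, mean_le (PB \x PW)%E (fun w => hsnorm (X k j w) `^ p) a) ->
    forall j, mean_le (PB \x PW)%E (fun w => hsnorm (X k.+1 j w) `^ p) (rho * a + K).
  move=> IH j.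
  have := @mean_le_ae _ _ _ (PB \x PW)%E (fun w => hsnorm (X k.+1 j w) `^ p)
    (fun w => weight_self lambda1 h * hsnorm (X k j w) `^ p
      + weight_mean lambda1 lambda2 h
        * (N.+1%:R^-1 * \sum_(l < N.+1) hsnorm (X k l w) `^ p)
      + noise_moment_bound m1 m2 b sigma0 sigma1 lambda1 lambda2 l0 Lhat phi h p
          (abs_moment_sum p (B j (k.+1%:R * h) w.1 - B j (k%:R * h) w.1))
          (abs_moment_sum p (Bb j (k.+1%:R * h) w.1 - Bb j (k%:R * h) w.1))
          (abs_moment_sum p (W (k.+1%:R * h) w.2 - W (k%:R * h) w.2))
          (abs_moment_sum p (Wb (k.+1%:R * h) w.2 - Wb (k%:R * h) w.2)))
    (rho * a + K) (mX _ _) (X_ge0 _ _); apply.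
    apply: filterS (scheme k j) => w /= [eqX _].
    exact: (powR_bem_step_le lambda1_gt0 lambda2_gt0 lambda12 l0_ge1 Lhat_gt0
      phi_ge0 phi_incr b_diss b_lip sigma_bound h_gt0 p_ge1 eqX).
  apply: mean_leD.
    have -> : rho * a = weight_self lambda1 h * a
        + weight_mean lambda1 lambda2 h * (N.+1%:R^-1 * (#|'I_N.+1|%:R * a)).
      by rewrite card_ord mulKf ?pnatr_eq0// -mulrDl.
    apply: mean_leD; first by apply: mean_leZ => //; exact: weight_self_ge0.
    apply: mean_leZ; first exact: weight_mean_ge0.
    by apply: mean_leZ; rewrite ?invr_ge0//; exact: mean_le_sum.
  apply: mean_leZ; first exact: noise_factor_ge0.
  apply: mean_leZ; first exact: powR_ge0.
  do 4 (apply: mean_leD; last by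
    do 2 (apply: mean_leZ; first exact: powR_ge0)).
  by apply: mean_le_cst; exact: powR_ge0.
have mean_n k : forall j, mean_le (PB \x PW)%E (fun w => hsnorm (X k j w) `^ p)
    (rho ^+ k * e0 + `|K| / (1 - rho)).
  elim: k => [|k IH] j.
    have [? ? ej] := mean0 j; split => //; apply: (le_trans ej).
    by rewrite lee_fin expr0 mul1r lerDl.
  have [? ? ej] := step _ _ IH j; split => //; apply: (le_trans ej).
  rewrite lee_fin mulrDr mulrA -exprS -addrA lerD2l.
  (* The constant reproduces itself under one step, so only the initial term decays. *)
  have fixpt : rho * (`|K| / (1 - rho)) + `|K| = `|K| / (1 - rho).
    by field; rewrite gt_eqF// subr_gt0.
  by rewrite -[leRHS]fixpt lerD2l ler_norm.
have [_ _] := mean_n n i; rewrite {1}/E_p unlock => /le_trans; apply.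
rewrite -E_p0_fin -EFinM -EFinD lee_fin addrA.
have e0_ge0 : 0 <= e0.
  by rewrite fine_ge0// /E_p unlock integral_ge0// => w _; rewrite lee_fin.
(* The power [rho ^+ n] is compared with the n-th power of the one-step exponential bound; the added
   1 in the constant is discarded last. *)
apply: (@le_trans _ _ (expR (- gamma * (n%:R * h)) * e0 + `|K| / (1 - rho))).
  rewrite lerD2r ler_wpM2r// mulrCA expRM_natl lerXn2r ?nnegrE ?expR_ge0//.
by rewrite lerDl.
Qed.
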